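(* Let $d,n\ge 1$. Let $\Sigma=U\Lambda U^\top$ be a $d\times d$ covariance matrix, where $U$ is orthogonal and $\Lambda=\mathrm{diag}(\lambda_1,\dots,\lambda_d)$. Let $x^{(1)},\dots,x^{(n+1)}\in\mathbb{R}^d$ be i.i.d. $\mathcal{N}(0,\Sigma)$, let $w_\star\sim\mathcal{N}(0,I_d)$ be independent of them, and set $y^{(i)}=\langle x^{(i)},w_\star\rangle$ for $i=1,\dots,n$. Let $$Z_0=\begin{bmatrix} x^{(1)} & \cdots & x^{(n)} & x^{(n+1)}\\ y^{(1)} & \cdots & y^{(n)} & 0\end{bmatrix}\in\mathbb{R}^{(d+1)\times(n+1)},\qquad M=\begin{bmatrix} I_n & 0\\ 0& 0\end{bmatrix}\in\mathbb{R}^{(n+1)\times(n+1)}.$$ For $b\in\mathbb{R}^{d+1}$ and $A\in\mathbb{R}^{(d+1)\times d}$ let $P=\begin{bmatrix}0_{d\times(d+1)}\\ b^\top\end{bmatrix}\in\mathbb{R}^{(d+1)\times(d+1)}$ and $Q=\begin{bmatrix}A & 0_{(d+1)\times 1}\end{bmatrix}\in\mathbb{R}^{(d+1)\times(d+1)}$, let $Z_1=Z_0+\frac1n PZ_0M(Z_0^\top QZ_0)$, and define $$f(b,A)=\mathbb{E}\Big[\big([Z_1]_{d+1,n+1}+w_\star^\top x^{(n+1)}\big)^2\Big].$$ Then the choice $$b^\top=[0\ 0\ \cdots\ 0\ 1],\qquad A=-\begin{bmatrix} U\,\mathrm{diag}\Big(\Big\{\frac{1}{\frac{n+1}{n}\lambda_i+\frac1n\sum_{k=1}^d\lambda_k}\Big\}_{i=1}^d\Big)U^\top\\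 0_{1\times d}\end{bmatrix}$$ is a global minimum of $f$ over all $b\in\mathbb{R}^{d+1}$, $A\in\mathbb{R}^{(d+1)\times d}$; moreover, for every $\gamma\neq0$, the rescaled pair $(\gamma b,\gamma^{-1}A)$ is also a global minimum.
   Context: $[X]_{i,j}$ denotes the $(i,j)$ entry of a matrix $X$. The expectation is over $x^{(1)},\dots,x^{(n+1)}$ and $w_\star$. *)

(* Defs.v *)
From HB Require Import structures.
From mathcomp Require Import all_boot all_order all_algebra.
From mathcomp Require Import all_classical all_reals all_analysis.
Set Implicit Arguments. Unset Strict Implicit. Unset Printing Implicit Defensive.
Import Order.TTheory GRing.Theory Num.Theory.
Local Open Scope ring_scope.

Fixpoint gauss_iter {R : realType} {I : eqType} (s : seq I)
    (F : (I -> R) -> \bar R) (z : I -> R) : \bar R :=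
  match s with
  | [::] => F z
  | i :: s' => (\int[normal_prob 0 1]_t
                 gauss_iter s' F (fun j => if j == i then t else z j))%E
  end.

(* E[F(omega)] where omega = (omega_i)_{i in I} are i.i.d. N(0,1). *)
Definition gauss_expect {R : realType} (I : finType) (F : (I -> R) -> \bar R)
  : \bar R := gauss_iter (enum I) F (fun _ => 0).

Section Model.
Variables (R : realType) (d n : nat).

(* source of randomness: a d x (n+1) standard Gaussian matrix G and a
   standard Gaussian vector w_star in R^d *)
Definition idx := (('I_d * 'I_(n + 1)) + 'I_d)%type.

Definition gmat (om : idx -> R) : 'M[R]_(d, n + 1) :=
  \matrix_(i, j) om (inl (i, j)).
Definition wstar (om : idx -> R) : 'cV[R]_d := \col_i om (inr i).

(* X = [x^(1) ... x^(n+1)] with x^(i) = U diag(sqrt lambda) g^(i) ~ N(0, U diag(lambda) U^T) *)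
Definition Xmat (U : 'M[R]_d) (lam : 'rV[R]_d) (om : idx -> R) : 'M[R]_(d, n + 1) :=
  U *m diag_mx (map_mx Num.sqrt lam) *m gmat om.

Definition Z0 (U : 'M[R]_d) (lam : 'rV[R]_d) (om : idx -> R) : 'M[R]_(d + 1, n + 1) :=
  let X := Xmat U lam om in
  let y : 'M[R]_(1, n) := (wstar om)^T *m lsubmx X in
  col_mx X (row_mx y (0 : 'M[R]_(1, 1))).

Definition Mmask : 'M[R]_(n + 1) := block_mx 1%:M 0 0 0.

Definition Pmat (b : 'cV[R]_(d + 1)) : 'M[R]_(d + 1) := col_mx (0 : 'M[R]_(d, d + 1)) b^T.
Definition Qmat (A : 'M[R]_(d + 1, d)) : 'M[R]_(d + 1) := row_mx A (0 : 'M[R]_(d + 1, 1)).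

Definition Z1 (U : 'M[R]_d) (lam : 'rV[R]_d) (b : 'cV[R]_(d + 1))
    (A : 'M[R]_(d + 1, d)) (om : idx -> R) : 'M[R]_(d + 1, n + 1) :=
  let Z := Z0 U lam om in
  Z + n%:R^-1 *: (Pmat b *m Z *m Mmask *m (Z^T *m Qmat A *m Z)).

Definition floss (U : 'M[R]_d) (lam : 'rV[R]_d) (b : 'cV[R]_(d + 1))
    (A : 'M[R]_(d + 1, d)) : \bar R :=
  gauss_expect (fun om : idx -> R =>
    ((Z1 U lam b A om (rshift d ord0) (rshift n ord0)
      + ((wstar om)^T *m rsubmx (Xmat U lam om)) ord0 ord0) ^+ 2)%:E).

Definition bopt : 'cV[R]_(d + 1) := col_mx 0 1.

Definition Aopt (U : 'M[R]_d) (lam : 'rV[R]_d) : 'M[R]_(d + 1, d) :=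
  - col_mx (U *m diag_mx (\row_i ((n.+1%:R / n%:R) * lam 0 i
                                  + n%:R^-1 * \sum_k lam 0 k)^-1) *m U^T)
           (0 : 'M[R]_(1, d)).
End Model.

(* Main.v *)
(** Let [Z] be the first [n] columns of [Z_0], [G = Z Z^T], [x] the query point and
    [w] the hidden weight.  The prediction error [w^T x + n^-1 b^T G A x] is affine
    in the entries of the tensor of [b] and [A], so the loss is a convex quadratic
    function of that tensor, and it suffices that the error at the proposed
    minimizer is orthogonal in L^2 to every [G_kl x_a].  With [K] the sum of the
    [x_i x_i^T] and [S = U diag(c) U^T] the preconditioner, this error is [w^T v]
    for [v = x - n^-1 K S x].  Entries of [G] of degree 0 or 2 in [w] give odd
    moments of [w].  For the entries of degree 1, integrating out [w] leaves
    [E[K v x^T] = 0]: for a standard Wishart matrix [W] and [L = diag(lambda)],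
    [E[W] = n] and [E[W L W] = n ((n + 1) L + tr L)], and the value of [c] makes
    the two terms cancel.  All quantities are polynomials in the Gaussian
    coordinates, so expectations can be computed on formal polynomials, through
    Stein's identity [E[X_i p] = E[dp/dX_i]]. *)
Require Import Defs.
From HB Require Import structures.
From mathcomp Require Import all_boot all_order all_algebra.
From mathcomp Require Import all_classical all_reals all_analysis.
From mathcomp Require Import measurable_realfun.
From mathcomp Require Import -(notations) ssrcomplements mpoly.
From mathcomp Require Import ring.
Set Implicit Arguments.
Unset Strict Implicit.
Unset Printing Implicit Defensive.
Import Order.TTheory GRing.Theory Num.Theory.
Local Open Scope ring_scope.

(** * Moments of the standard normal law *)

Section GaussianMoments.
Import numFieldNormedType.Exports.
Local Open Scope classical_set_scope.
Variable R : realType.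
Implicit Types (k : nat) (t : R).
Local Notation leb := (@lebesgue_measure R).
Local Notation phi := (normal_pdf (0 : R) 1).
Local Notation gauss := (@normal_prob R 0 1).

Lemma phiE t : phi t = normal_peak 1 * expR (- (t ^+ 2 / 2)).
Proof.
rewrite normal_pdfE ?oner_eq0// /normal_fun; congr (_ * expR _).
by rewrite subr0 expr1n mulNr.
Qed.

(** The exponential dominates the term of order [k.+1] of its series at [t ^+ 2 / 4], hence a
    multiple of [|t|^(2(k+1))]. Together with the constant 1 this controls [|t|^k] on both sides of
    [|t| = 1]. *)
Lemma expr_le_expR k t :
  `|t| ^+ k <= 4 ^+ k.+1 * (k.+1)`!%:R * expR (t ^+ 2 / 4).
Proof.
have fact_ge1 : 1 <= (k.+1)`!%:R :> R by rewrite ler1n fact_gt0.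
have pow_ge1 : 1 <= 4 ^+ k.+1 :> R by rewrite exprn_ege1// ler1n.
apply: (@le_trans _ _ (1 + `|t| ^+ (2 * k.+1))).
  have [t1|/ltW t1] := leP `|t| 1.
    by rewrite ler_wpDr ?exprn_ge0// exprn_ile1.
  by rewrite ler_wpDl// ler_weXn2l// (leq_trans (leqnSn k))// leq_pmull.
apply: (@le_trans _ _
    (4 ^+ k.+1 * (k.+1)`!%:R * (1 + (t ^+ 2 / 4) ^+ k.+1 / (k.+1)`!%:R))).
  rewrite mulrDr mulr1 lerD//.
    by rewrite -[leLHS]mulr1 ler_pM.
  rewrite exprM real_normK ?num_real// expr_div_n.
  rewrite le_eqVlt; apply/orP; left; apply/eqP.
  field.
  by rewrite (gt_eqF (lt_le_trans ltr01 _))//= expf_neq0// pnatr_eq0.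
rewrite ler_wpM2l ?mulr_ge0 ?ler0n ?exprn_ge0//.
by apply: expR_ge1Dxn; rewrite divr_ge0 ?sqr_ge0.
Qed.

(** Half of the Gaussian exponent absorbs the power of [t]; the remaining [exp(-t^2/4)] is, up to
    normalisation, the density of variance 2. This bound serves both for integrability and for decay
    at infinity. *)
Lemma expr_phi_le k : exists2 C : R, 0 <= C &
  forall t, `|t ^+ k * phi t| <= C * normal_pdf 0 (Num.sqrt 2) t.
Proof.
pose C : R := 4 ^+ k.+1 * (k.+1)`!%:R * normal_peak 1 / normal_peak (Num.sqrt 2).
have s2 : Num.sqrt 2 != 0 :> R by rewrite gt_eqF// sqrtr_gt0.
exists C.
  by rewrite /C !mulr_ge0 ?invr_ge0 ?normal_peak_ge0 ?exprn_ge0.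
move=> t; rewrite normrM normrX (ger0_norm (normal_pdf_ge0 _ _ _)).
rewrite phiE normal_pdfE// /normal_fun subr0 sqr_sqrtr//.
have -> : - t ^+ 2 / (2 *+ 2) = t ^+ 2 / 4 - t ^+ 2 / 2 :> R.
  by rewrite -mulr_natr; field.
rewrite /C [leRHS]mulrA divfK ?gt_eqF ?normal_peak_gt0// expRD expRN.
rewrite [leRHS](_ : _ = (4 ^+ k.+1 * (k.+1)`!%:R * expR (t ^+ 2 / 4))
  * (normal_peak 1 / expR (t ^+ 2 / 2))); last by field; rewrite gt_eqF ?expR_gt0.
rewrite ler_wpM2r ?expr_le_expR//.
by rewrite divr_ge0 ?normal_peak_ge0 ?expR_ge0.
Qed.

Lemma continuous_expr_phi k : continuous (fun t => t ^+ k * phi t).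
Proof.
move=> t; apply: cvgM; first exact: exprn_continuous.
by apply: continuous_normal_pdf; rewrite oner_eq0.
Qed.

Lemma measurable_expr_phi k : measurable_fun setT (fun t => t ^+ k * phi t).
Proof. by apply: continuous_measurable_fun; exact: continuous_expr_phi. Qed.

Lemma integrable_expr_phi k :
  leb.-integrable setT (fun t => (t ^+ k * phi t)%:E).
Proof.
have [C C0 leC] := expr_phi_le k.
have intC : leb.-integrable setT
    (fun t => (C * normal_pdf 0 (Num.sqrt 2) t)%:E).
  under eq_fun do rewrite EFinM.
  by apply: integrableZl => //; exact: integrable_normal_pdf.
apply: (le_integrable measurableT _ _ intC).
  by apply/measurable_EFinP; exact: measurable_expr_phi.
move=> t _; rewrite /= lee_fin (le_trans (leC t))// ger0_norm//.
by rewrite mulr_ge0// normal_pdf_ge0.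
Qed.

(** The fundamental theorem of calculus applies on [[-n, n]], and dominated convergence, with [|f|]
    as dominating function, passes to the whole line. *)
Lemma integral_derive_eq0 (F f : R -> R) : continuous f ->
  leb.-integrable setT (EFin \o f) ->
  (forall t, is_derive t 1 F (f t)) ->
  (F n%:R @[n --> \oo] --> 0) -> (F (- n%:R) @[n --> \oo] --> 0) ->
  (\int[leb]_t (f t)%:E = 0)%E.
Proof.
move=> cf intf dF F0 FN0.
pose fn (n : nat) := (EFin \o f) \_ (`[- n%:R, n%:R] : set R).
have mfn n : measurable_fun setT (fn n).
  apply/(measurable_restrictT _ _).1 => //.
  by apply: measurable_funTS; case/integrableP: intf.
have fn_f t : fn n t @[n --> \oo] --> (f t)%:E.
  apply: cvg_near_cst; near=> n; rewrite /fn /patch ifT//.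
  rewrite inE/= in_itv/= -ler_norml.
  by near: n; exact: nbhs_infty_ger.
have fn_le n t : (`|fn n t| <= `|(f t)%:E|)%E.
  by rewrite /fn /patch; case: ifP => // _; rewrite abse0.
have [//|||//||_ _ cvg_int] := @dominated_convergence _ _ R leb setT measurableT
  fn (EFin \o f) (abse \o (EFin \o f)).
- by case/integrableP: intf.
- by apply: aeW => t _; exact: fn_f.
- exact: integrable_abse.
- by apply: aeW => t n _; exact: fn_le.
suff int0 : (fun n => \int[leb]_t fn n t)%E @ \oo --> 0%E.
  exact: (cvg_unique _ cvg_int int0).
(* The shift to [n.+1] keeps the interval nondegenerate, as the fundamental theorem requires. *)
have intE n : (\int[leb]_t fn n.+1 t = (F n.+1%:R)%:E - (F (- n.+1%:R))%:E)%E.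
  rewrite -integral_mkcond; apply: continuous_FTC2.
  - by rewrite gtrN// ltr0n.
  - exact: continuous_subspaceT.
  - have cF t : F @ t --> F t.
      by apply: differentiable_continuous; apply/derivable1_diffP; case: (dF t).
    by split => //; [exact: cvg_at_right_filter|exact: cvg_at_left_filter].
  - by move=> t _; rewrite derive1E; case: (dF t).
rewrite -(cvg_shiftS (fun n => \int[leb]_t fn n t)%E).
under eq_fun do rewrite intE -EFinB.
apply: cvg_EFin; first exact: nearW.
rewrite -[X in _ --> X](subr0 0).
by apply: (cvgB (f := fun n => F n.+1%:R) (g := fun n => F (- n.+1%:R)));
  [rewrite (cvg_shiftS (fun n => F n%:R))|
   rewrite (cvg_shiftS (fun n => F (- n%:R)))].
Unshelve. all: by end_near. Qed.

Lemma is_derive_phi t : is_derive t 1 phi (- (t * phi t)).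
Proof.
have -> : phi = fun u : R => normal_peak 1 * expR (- (u ^+ 2 / 2)).
  by apply/funext => u; exact: phiE.
apply: is_derive_eq.
rewrite /GRing.scale/= ?scaler0 ?addr0 ?add0r.
by field.
Qed.

Lemma is_derive_expr_phi k t : is_derive t 1 (fun u => u ^+ k * phi u)
  (k%:R * (t ^+ k.-1 * phi t) - t ^+ k.+1 * phi t).
Proof.
have dphi := is_derive_phi t.
have did := is_deriveX k (is_derive_id t (1 : R)).
rewrite exprfctE in did; apply: (is_derive_eq (is_deriveM did dphi)).
rewrite /GRing.scale/= exprS -mulr_natl; ring.
Qed.

(** The sign [e] treats both ends of the line at once. Bounding the next power [k.+1] and dividing
    by [n] yields a decay of order [1/n]. *)
Lemma cvg_expr_phi_nat (e : R) k : `|e| = 1 ->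
  (e * n%:R) ^+ k * phi (e * n%:R) @[n --> \oo] --> 0.
Proof.
move=> e1; have [C C0 leC] := expr_phi_le k.+1.
pose D := C * normal_peak (Num.sqrt 2).
have s2 : Num.sqrt 2 != 0 :> R by rewrite gt_eqF// sqrtr_gt0.
have leD n : `|(e * n.+1%:R) ^+ k * phi (e * n.+1%:R)| <= D * n.+1%:R^-1.
  rewrite ler_pdivlMr ?ltr0n// mulrC.
  have en : n.+1%:R = `|e * n.+1%:R| by rewrite normrM e1 mul1r normr_nat.
  rewrite [X in X * _]en -normrM mulrA -exprS (le_trans (leC _))// ler_wpM2l//.
  exact: normal_pdf_ub.
rewrite -(cvg_shiftS (fun n => (e * n%:R) ^+ k * phi (e * n%:R))).
apply: norm_cvg0; apply: (@squeeze_cvgr _ _ _ _ (cst 0) (fun n => D * n.+1%:R^-1)).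
- by apply: nearW => n; rewrite /= normr_ge0 leD.
- exact: cvg_cst.
- rewrite -[X in _ --> X](mulr0 D).
  by apply: cvgM; [exact: cvg_cst|exact: cvg_harmonic].
Qed.

(* The right-hand side minus the left-hand side integrates [(t^k phi)']. *)
Lemma integral_expr_phiS k :
  (\int[leb]_t (t ^+ k.+1 * phi t)%:E =
   k%:R%:E * \int[leb]_t (t ^+ k.-1 * phi t)%:E)%E.
Proof.
have intk := integrable_expr_phi k.-1; have intS := integrable_expr_phi k.+1.
have intf : leb.-integrable setT
    (fun t => k%:R%:E * (t ^+ k.-1 * phi t)%:E)%E.
  exact: (integrableZl measurableT).
suff : (k%:R%:E * \int[leb]_t (t ^+ k.-1 * phi t)%:E -
    \int[leb]_t (t ^+ k.+1 * phi t)%:E = 0)%E.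
  move: (integrable_fin_num measurableT intk) => /fineK <-.
  move: (integrable_fin_num measurableT intS) => /fineK <-.
  by rewrite -EFinM -EFinB => -[] /subr0_eq ->.
rewrite -integralZl// -integralB//.
rewrite -[RHS](@integral_derive_eq0 (fun t => t ^+ k * phi t)
  (fun t => k%:R * (t ^+ k.-1 * phi t) - t ^+ k.+1 * phi t)).
- by apply: eq_integral => t _.
- move=> t; apply: cvgB; last exact: continuous_expr_phi.
  by apply: cvgM; [exact: cvg_cst|exact: continuous_expr_phi].
- exact: (integrableB _ intf intS).
- exact: is_derive_expr_phi.
- under eq_fun do rewrite -[X in X ^+ k]mul1r -[X in phi X]mul1r.
  by apply: cvg_expr_phi_nat; rewrite normr1.
- under eq_fun do rewrite -[X in X ^+ k]mulN1r -[X in phi X]mulN1r.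
  by apply: cvg_expr_phi_nat; rewrite normrN1.
Qed.

(** The Radon-Nikodym derivative of the normal law agrees almost everywhere with [phi], since both
    have the same integral over every measurable set. *)
Lemma ge0_integral_gauss (f : R -> \bar R) :
  (forall t, (0 <= f t)%E) -> measurable_fun setT f ->
  (\int[gauss]_t f t = \int[leb]_t (f t * (phi t)%:E))%E.
Proof.
move=> f0 mf; have gleb := @normal_prob_dominates R 0 1.
have mphi : measurable_fun setT (EFin \o phi).
  by apply/measurable_EFinP; exact: measurable_normal_pdf.
have intd := Radon_Nikodym_SigmaFinite.f_integrable gleb.
rewrite -(Radon_Nikodym_SigmaFinite.change_of_variables gleb)//.
apply: ae_eq_integral => //.
- by apply: emeasurable_funM => //; case/integrableP: intd.
- exact: emeasurable_funM.
- apply: ae_eqe_mul2l; apply: integral_ae_eq => // E _ mE.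
  by rewrite -Radon_Nikodym_SigmaFinite.f_integral.
Qed.

Lemma integrable_gauss k : gauss.-integrable setT (fun t => (t ^+ k)%:E).
Proof.
have mX : measurable_fun setT (fun t => (t ^+ k)%:E).
  by apply/measurable_EFinP; exact: exprn_measurable.
apply/integrableP; split => //.
rewrite ge0_integral_gauss//; last exact: measurableT_comp.
have /integrableP[_] := integrable_expr_phi k.
congr (_ < _)%E; apply: eq_integral => t _ /=.
by rewrite normrM (ger0_norm (normal_pdf_ge0 _ _ _)) EFinM.
Qed.

Lemma integral_gauss_expr k :
  (\int[gauss]_t (t ^+ k)%:E = \int[leb]_t (t ^+ k * phi t)%:E)%E.
Proof.
have mX : measurable_fun setT (fun t => (t ^+ k)%:E).
  by apply/measurable_EFinP; exact: exprn_measurable.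
have phi_ge0 t : (0 <= (phi t)%:E)%E by rewrite lee_fin normal_pdf_ge0.
(* The change of density is available for nonnegative functions, so positive and negative parts are
   treated separately. *)
rewrite integralE [RHS]integralE; congr (_ - _)%E.
- rewrite ge0_integral_gauss//; last exact: measurable_funepos.
  apply: eq_integral => t _; rewrite !funeposE EFinM.
  by rewrite -[in RHS](mul0e (phi t)%:E) maxe_pMl.
- rewrite ge0_integral_gauss//; last exact: measurable_funeneg.
  apply: eq_integral => t _; rewrite !funenegE EFinM.
  by rewrite -[in RHS](mul0e (phi t)%:E) -mulNe maxe_pMl.
Qed.

Definition gauss_moment k : R := fine (\int[gauss]_t (t ^+ k)%:E)%E.

Lemma gauss_momentE k : (\int[gauss]_t (t ^+ k)%:E = (gauss_moment k)%:E)%E.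
Proof. by rewrite fineK// integrable_fin_num//; exact: integrable_gauss. Qed.

Lemma gauss_moment0 : gauss_moment 0 = 1.
Proof.
apply: EFin_inj; rewrite -gauss_momentE integral_gauss_expr.
by under eq_integral do rewrite expr0 mul1r; rewrite integral_normal_pdf.
Qed.

(** One-dimensional integration by parts. At [k = 0] the truncated predecessor is harmless: the
    factor [k%:R] vanishes, giving a zero first moment. *)
Lemma gauss_momentS k : gauss_moment k.+1 = k%:R * gauss_moment k.-1.
Proof.
apply: EFin_inj; rewrite EFinM -!gauss_momentE !integral_gauss_expr.
exact: integral_expr_phiS.
Qed.

Lemma integral_gauss_sum (I : Type) (r : seq I) (c : I -> R) (e : I -> nat) :
  (\int[gauss]_t (\sum_(i <- r) c i * t ^+ e i)%:E =
   (\sum_(i <- r) c i * gauss_moment (e i))%:E)%E.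
Proof.
(* Integrability joins the induction because additivity of the integral requires it of the tail. *)
suff [] : gauss.-integrable setT (fun t => (\sum_(i <- r) c i * t ^+ e i)%:E) /\
    (\int[gauss]_t (\sum_(i <- r) c i * t ^+ e i)%:E =
     (\sum_(i <- r) c i * gauss_moment (e i))%:E)%E by [].
elim: r => [|i r [intr IHr]].
  split; first by under eq_fun do rewrite big_nil; exact: integrable0.
  by under eq_integral do rewrite big_nil; rewrite integral0 big_nil.
have inti : gauss.-integrable setT (fun t => (c i)%:E * (t ^+ e i)%:E)%E.
  exact: (integrableZl measurableT _ (integrable_gauss _)).
have sumE t : (\sum_(j <- i :: r) c j * t ^+ e j)%:E =
    ((c i)%:E * (t ^+ e i)%:E + (\sum_(j <- r) c j * t ^+ e j)%:E)%E.
  by rewrite big_cons EFinD EFinM.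
split; first by under eq_fun do rewrite sumE; exact: integrableD.
under eq_integral do rewrite sumE.
rewrite integralD// IHr integralZl//; last exact: integrable_gauss.
by rewrite gauss_momentE big_cons.
Qed.

End GaussianMoments.

(** * Gaussian expectation of formal polynomials *)

Section GaussianPolynomials.
Variables (R : realType) (I : finType).
Local Notation P := (mpoly #|I| R).
Local Notation mu := (@gauss_moment R).

(* Coordinates in [I] are numbered through [enum_rank] to fit [mpoly]. *)
Definition pX (i : I) : P := mpolyX R (mnm1 (enum_rank i)).

Definition pD (i : I) (p : P) : P := mderiv (enum_rank i) p.

Definition peval (om : I -> R) (p : P) : R := meval (fun k => om (enum_val k)) p.

(** The expectation is defined algebraically, monomial by monomial, as independence of the
    coordinates dictates; [gauss_expect_peval] ties it to the iterated integral. *)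
Definition pE (p : P) : R :=
  \sum_(m <- msupp p) mcoeff m p * \prod_(k < #|I|) mu (m k).

HB.instance Definition _ i := GRing.Linear.copy (pD i) (mderiv (enum_rank i)).
HB.instance Definition _ om := GRing.RMorphism.copy (peval om)
  (meval (fun k => om (enum_val k))).

(** A fixed index set, large enough for several polynomials, lets their sums be compared term by
    term; this gives linearity. *)
Lemma pE_widen b p : (msize p <= b)%N ->
  pE p = \sum_(m : bmultinom #|I| b) mcoeff m p * \prod_(k < #|I|) mu (bmnm m k).
Proof.
move=> pb; rewrite /pE (big_mksub (bmultinom #|I| b)) ?msupp_uniq//=; last first.
  by move=> m /msize_mdeg_lt /leq_trans; apply.
by rewrite big_rmcond//= => m /memN_msupp_eq0 ->; rewrite mul0r.
Qed.

Lemma pE_is_linear : linear_for *%R pE.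
Proof.
move=> a p q; pose b := maxn (maxn (msize p) (msize q)) (msize (a *: p + q)).
rewrite !(@pE_widen b) ?leq_max ?leqnn ?orbT//.
rewrite mulr_sumr -big_split; apply: eq_bigr => m _.
by rewrite mcoeffD mcoeffZ mulrDl mulrA.
Qed.

HB.instance Definition _ := GRing.isLinear.Build R P R *%R pE pE_is_linear.

Lemma pE_mpolyX m : pE (mpolyX R m) = \prod_(k < #|I|) mu (m k).
Proof. by rewrite /pE msuppX big_seq1 mcoeffX eqxx mul1r. Qed.

(** The induction invariant for partial integration: coordinates in [s] already contribute moments,
    the others still contribute powers of [z]. *)
Lemma gauss_iter_peval p s z : uniq s ->
  gauss_iter s (fun om => (peval om p)%:E) z =
  (\sum_(m <- msupp p) mcoeff m p *
    \prod_i (if i \in s then mu (m (enum_rank i)) else z i ^+ m (enum_rank i)))%:E.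
Proof.
elim: s z => [|i s IHs] z /=.
  move=> _; rewrite /peval mevalE; congr EFin; apply: eq_bigr => m _.
  congr (_ * _); rewrite (reindex_onto enum_rank enum_val) => [|k _].
    by apply: eq_big => k; rewrite ?enum_rankK ?eqxx.
  by rewrite enum_valK.
case/andP => iNs us.
(* As [i] does not occur in the tail of the list, the inner integral is a polynomial in [t] whose
   coefficients do not depend on [t]. *)
have inner (t : R) :
    gauss_iter s (fun om => (peval om p)%:E) (fun j => if j == i then t else z j)
    = (\sum_(m <- msupp p)
        (mcoeff m p * \prod_(j | j != i) (if j \in s then mu (m (enum_rank j))
           else z j ^+ m (enum_rank j))) * t ^+ m (enum_rank i))%:E.
  rewrite IHs//; congr EFin; apply: eq_bigr => m _.
  rewrite -mulrA; congr (_ * _); rewrite (bigD1 i)//= (negPf iNs) eqxx mulrC.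
  by congr (_ * _); apply: eq_bigr => j /negPf ->.
under eq_integral do rewrite inner.
rewrite integral_gauss_sum; congr EFin; apply: eq_bigr => m _.
rewrite -mulrA; congr (_ * _); rewrite [RHS](bigD1 i)//= inE eqxx mulrC.
by congr (_ * _); apply: eq_bigr => j /negPf; rewrite inE => ->.
Qed.

Lemma gauss_expect_peval p : gauss_expect (fun om => (peval om p)%:E) = (pE p)%:E.
Proof.
rewrite /gauss_expect gauss_iter_peval ?enum_uniq//; congr EFin.
apply: eq_bigr => m _; congr (_ * _).
rewrite [RHS](reindex_onto enum_rank enum_val) => [|k _]; last by rewrite enum_valK.
by apply: eq_big => k; rewrite ?enum_rankK ?eqxx// mem_enum.
Qed.

Lemma gauss_expect_ge0 (F : (I -> R) -> \bar R) :
  (forall om, (0 <= F om)%E) -> (0 <= gauss_expect F)%E.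
Proof.
move=> F0; rewrite /gauss_expect.
by elim: (enum I) (fun=> 0) => [|i s IHs] z//=; apply: integral_ge0.
Qed.

Lemma pE_sqr_ge0 p : 0 <= pE (p ^+ 2).
Proof.
rewrite -lee_fin -gauss_expect_peval; apply: gauss_expect_ge0 => om.
by rewrite lee_fin /peval rmorphXn sqr_ge0.
Qed.

(** Stein's identity. By linearity it reduces to monomials, where it is the moment recursion applied
    to the exponent of coordinate [i]. *)
Lemma pE_pXM i p : pE (pX i * p) = pE (pD i p).
Proof.
rewrite {1 2}(mpolyE p) mulr_sumr [pD i _]linear_sum !linear_sum/=.
apply: eq_bigr => m _; rewrite -scalerAr /pD mderivZ !linearZ/=; congr (_ * _).
rewrite -mpolyXD mderivX linearZ/= !pE_mpolyX.
rewrite (bigD1 (enum_rank i))//= [in RHS](bigD1 (enum_rank i))//= mulrA.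
rewrite mnmDE mnmBE mnm1E eqxx add1n gauss_momentS subn1; congr (_ * _).
by apply: eq_bigr => k ki; rewrite mnmDE mnmBE mnm1E eq_sym (negPf ki) subn0.
Qed.

Lemma pD_pX i j : pD i (pX j) = (i == j)%:R.
Proof.
rewrite /pD mderivX mnm1E (can_eq enum_rankK) eq_sym.
case: eqP => [->|_]; last by rewrite scale0r.
by rewrite scale1r -[X in mnm_sub X _]add0m addmK mpolyX0.
Qed.

Lemma pDM i p q : pD i (p * q) = pD i p * q + p * pD i q.
Proof. exact: mderivM. Qed.

Lemma pDC i c : pD i (mpolyC _ c) = 0.
Proof. exact: mderivC. Qed.

Lemma peval_pX om i : peval om (pX i) = om i.
Proof. by rewrite /peval mevalXU enum_rankK. Qed.

Lemma pevalC om c : peval om (mpolyC _ c) = c.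
Proof. exact: mevalC. Qed.

Lemma pECM c p : pE (mpolyC _ c * p) = c * pE p.
Proof. by rewrite mul_mpolyC linearZ. Qed.

Lemma pE1 : pE 1 = 1.
Proof.
by rewrite -mpolyX0 pE_mpolyX big1// => k _; rewrite mnm0E gauss_moment0.
Qed.
End GaussianPolynomials.
Arguments pX {R I}.
Arguments pE {R I}.

(** * Gaussian vectors and Wishart matrices *)

Section GaussianMatrices.
Variables (R : realType) (I : finType).
Local Notation P := (mpoly #|I| R).

Definition pC (m n : nat) (A : 'M[R]_(m, n)) : 'M[P]_(m, n) :=
  map_mx (@mpolyC #|I| R) A.

Lemma pCZ m n c (A : 'M[R]_(m, n)) : pC (c *: A) = mpolyC _ c *: pC A.
Proof. exact: map_mxZ. Qed.

Lemma pCM m n k (A : 'M[R]_(m, n)) (B : 'M[R]_(n, k)) : pC (A *m B) = pC A *m pC B.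
Proof. exact: map_mxM. Qed.

Lemma pC_tr m n (A : 'M[R]_(m, n)) : pC A^T = (pC A)^T.
Proof. by rewrite /pC matrix.map_trmx. Qed.

Lemma pE_pairM i j (p : P) : pD i p = 0 ->
  pE (pX i * pX j * p) = (i == j)%:R * pE p.
Proof.
move=> Dp; rewrite -mulrA pE_pXM !pDM pD_pX Dp mulr0 addr0.
by rewrite mulr_natl raddfMn mulr_natl.
Qed.

Lemma pE_single i (p : P) : pD i p = 0 -> pE (pX i * p) = 0.
Proof. by move=> Dp; rewrite pE_pXM Dp raddf0. Qed.

Lemma pE_triple i j k (p : P) : (forall l, l \in [:: i; j; k] -> pD l p = 0) ->
  pE (pX i * pX j * pX k * p) = 0.
Proof.
move=> Dp; rewrite -!mulrA pE_pXM !pDM !pD_pX Dp ?inE ?eqxx// mulr0 addr0.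
rewrite raddfD/= !mulr_natl mulrnAr !raddfMn/= !pE_single ?mul0rn ?addr0//.
all: by apply: Dp; rewrite !inE eqxx ?orbT.
Qed.

(** Wick's formula: Stein's identity pairs the first variable with each of the other three, leaving
    a second moment each time. *)
Lemma pE_wick4 i j k l : pE (pX i * pX j * pX k * pX l : P) =
  (i == j)%:R * (k == l)%:R + (i == k)%:R * (j == l)%:R
  + (i == l)%:R * (j == k)%:R.
Proof.
have pE2 a b : pE (pX a * pX b : P) = (a == b)%:R.
  by rewrite -[_ * pX b]mulr1 pE_pairM ?pE1 ?mulr1// -mpolyC1 pDC.
rewrite -!mulrA pE_pXM !pDM !pD_pX !mulr_natl mulrDr addrA.
by rewrite !mulrnAr !mulr1 !raddfD/= !raddfMn/= !pE2.
Qed.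

Lemma pD_mulmx i m n k (A : 'M[P]_(m, n)) (B : 'M[P]_(n, k)) :
  map_mx (pD i) A = 0 -> map_mx (pD i) B = 0 -> map_mx (pD i) (A *m B) = 0.
Proof.
move=> /matrixP DA /matrixP DB; apply/matrixP => a b; rewrite !mxE raddf_sum.
rewrite big1//= => c _; rewrite pDM.
by move: (DA a c) (DB c b); rewrite !mxE => -> ->; rewrite mul0r mulr0 addr0.
Qed.

Lemma pD_trmx i m n (A : 'M[P]_(m, n)) :
  map_mx (pD i) A = 0 -> map_mx (pD i) A^T = 0.
Proof. by move=> DA; rewrite -matrix.map_trmx DA trmx0. Qed.

Lemma pD_subZ i m n c (A B : 'M[P]_(m, n)) :
  map_mx (pD i) A = 0 -> map_mx (pD i) B = 0 ->
  map_mx (pD i) (A - (mpolyC _ c) *: B) = 0.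
Proof.
move=> /matrixP DA /matrixP DB; apply/matrixP => a b; rewrite !mxE raddfB/= pDM pDC.
by move: (DA a b) (DB a b); rewrite !mxE => -> ->; rewrite mul0r mulr0 addr0 subr0.
Qed.

Lemma pD_pC i m n (A : 'M[R]_(m, n)) : map_mx (pD i) (pC A) = 0.
Proof. by apply/matrixP => a b; rewrite !mxE pDC. Qed.

Lemma pE_mulCmx m n k (A : 'M[R]_(m, n)) (B : 'M[P]_(n, k)) :
  map_mx (pE) (pC A *m B) = A *m map_mx (pE) B.
Proof.
apply/matrixP => a b; rewrite !mxE raddf_sum; apply: eq_bigr => c _.
by rewrite !mxE/= pECM.
Qed.

Lemma pE_mulmxC m n k (A : 'M[P]_(m, n)) (B : 'M[R]_(n, k)) :
  map_mx (pE) (A *m pC B) = map_mx (pE) A *m B.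
Proof.
apply/matrixP => a b; rewrite !mxE raddf_sum; apply: eq_bigr => c _.
by rewrite !mxE/= mulrC pECM mulrC.
Qed.

Lemma pE_subZ m n c (A B : 'M[P]_(m, n)) :
  map_mx pE (A - mpolyC _ c *: B) = map_mx pE A - c *: map_mx pE B.
Proof. by apply/matrixP => i j; rewrite !mxE raddfB/= pECM. Qed.

Lemma peval_pC om m n (A : 'M[R]_(m, n)) : map_mx (@peval R I om) (pC A) = A.
Proof. by apply/matrixP => a b; rewrite !mxE/= pevalC. Qed.

End GaussianMatrices.

(** * Integrating out a standard Gaussian vector *)

Section GaussianVector.
Variables (R : realType) (I : finType) (d : nat) (wi : 'I_d -> I).
Hypothesis wi_inj : injective wi.
Local Notation P := (mpoly #|I| R).

Definition gvec : 'cV[P]_d := \col_i pX (wi i).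
(* [A] does not involve the coordinates of [gvec]. *)
Definition gfree m k (A : 'M[P]_(m, k)) := forall b, map_mx (pD (wi b)) A = 0.

Lemma gfree_entry m k (A : 'M[P]_(m, k)) i j b :
  gfree A -> pD (wi b) (A i j) = 0.
Proof. by move=> /(_ b) /matrixP /(_ i j); rewrite !mxE. Qed.

Lemma gfreeM m k l (A : 'M[P]_(m, k)) (B : 'M[P]_(k, l)) :
  gfree A -> gfree B -> gfree (A *m B).
Proof. by move=> fA fB b; apply: pD_mulmx. Qed.

Lemma gfreeC m k (A : 'M[R]_(m, k)) : gfree (pC I A).
Proof. by move=> b; apply: pD_pC. Qed.

Lemma gfree_tr m k (A : 'M[P]_(m, k)) : gfree A -> gfree A^T.
Proof. by move=> fA b; apply: pD_trmx. Qed.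

Lemma gfree_subZ m k c (A B : 'M[P]_(m, k)) :
  gfree A -> gfree B -> gfree (A - (mpolyC _ c) *: B).
Proof. by move=> fA fB b; apply: pD_subZ. Qed.

Let freeM2 b (p q : P) : pD (wi b) p = 0 -> pD (wi b) q = 0 ->
  pD (wi b) (p * q) = 0.
Proof. by move=> Dp Dq; rewrite pDM Dp Dq mul0r mulr0 addr0. Qed.

Lemma gvec_dot (v : 'cV[P]_d) : (gvec^T *m v) 0 0 = \sum_b pX (wi b) * v b 0.
Proof. by rewrite !mxE; apply: eq_bigr => b _; rewrite !mxE. Qed.

Lemma pE_gvec1 (v y : 'cV[P]_d) m k (K : 'M[P]_(m, k)) i j a :
  gfree v -> gfree K -> gfree y ->
  pE ((gvec^T *m v) 0 0 * (K i j * y a 0)) = 0.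
Proof.
move=> fv fK fy; rewrite gvec_dot mulr_suml raddf_sum big1//= => b _.
by rewrite -mulrA pE_single// !freeM2// gfree_entry.
Qed.

(** The two occurrences of the vector contract to the identity, its covariance: only the products of
    a coordinate with itself survive. This is the one even case; [pE_gvec1] and [pE_gvec3] are odd
    moments. *)
Lemma pE_gvec2 (v y : 'cV[P]_d) m (K : 'M[P]_(m, d)) i a :
  gfree v -> gfree K -> gfree y ->
  pE ((gvec^T *m v) 0 0 * ((K *m gvec) i 0 * y a 0)) =
  pE ((K *m v *m y^T) i a).
Proof.
move=> fv fK fy; rewrite gvec_dot mulr_suml [in RHS]mxE big_ord1 !mxE.
rewrite [in RHS]mulr_suml !raddf_sum/=; apply: eq_bigr => b _.
rewrite mulr_suml mulr_sumr raddf_sum/= (bigD1 b)//= big1 => [|c cb].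
  rewrite addr0 !mxE.
  rewrite [X in pE X](_ : _ = pX (wi b) * pX (wi b) * (K i b * v b 0 * y a 0)).
    by rewrite pE_pairM ?eqxx ?mul1r// !freeM2// gfree_entry.
  by ring.
rewrite !mxE.
rewrite [X in pE X](_ : _ = pX (wi b) * pX (wi c) * (K i c * v b 0 * y a 0)).
  rewrite pE_pairM; last by rewrite !freeM2// gfree_entry.
  by rewrite (inj_eq wi_inj) eq_sym (negPf cb) mul0r.
by ring.
Qed.

Lemma pE_gvec3 (v y : 'cV[P]_d) (K : 'M[P]_d) a :
  gfree v -> gfree K -> gfree y ->
  pE ((gvec^T *m v) 0 0 * ((gvec^T *m K *m gvec) 0 0 * y a 0)) = 0.
Proof.
move=> fv fK fy; rewrite -[gvec^T *m K *m gvec]mulmxA !gvec_dot.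
rewrite mulr_suml raddf_sum big1//= => b _.
rewrite mulr_suml mulr_sumr raddf_sum big1//= => c _.
rewrite mxE mulr_sumr mulr_suml mulr_sumr raddf_sum big1//= => e _.
rewrite !mxE.
rewrite [X in pE X](_ : _ =
  pX (wi b) * pX (wi c) * pX (wi e) * (v b 0 * K c e * y a 0)); last by ring.
apply: pE_triple => l; rewrite !inE.
by case/or3P => /eqP ->; rewrite !freeM2// gfree_entry.
Qed.

Lemma pE_gvec_cov m (B : 'M[P]_(m, d)) : gfree B ->
  map_mx pE (B *m gvec *m gvec^T) = map_mx pE B.
Proof.
move=> fB; apply/matrixP => i j; rewrite !mxE big_ord1 !mxE mulr_suml raddf_sum/=.
rewrite (bigD1 j)//= big1 => [|c cj].
  rewrite addr0 !mxE -mulrA mulrC pE_pairM ?eqxx ?mul1r//.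
  exact: gfree_entry.
rewrite !mxE -mulrA mulrC pE_pairM; last exact: gfree_entry.
by rewrite (inj_eq wi_inj) (negPf cj) mul0r.
Qed.
End GaussianVector.
Arguments gvec {R I d}.

(** * First and second moments of a Wishart matrix *)

Section Wishart.
Variables (R : realType) (I : finType) (d n : nat) (gi : 'I_d -> 'I_n -> I).
Hypothesis gi_inj : forall i j i' j', (gi i j == gi i' j') = (i == i') && (j == j').
Local Notation P := (mpoly #|I| R).

Definition gmx : 'M[P]_(d, n) := \matrix_(i, j) pX (gi i j).
Definition wishart : 'M[P]_d := gmx *m gmx^T.

Lemma pE_wishart : map_mx pE wishart = n%:R%:M.
Proof.
apply/matrixP => a b; rewrite !mxE raddf_sum/=.
under eq_bigr => i _ do
  rewrite !mxE -[_ * pX _]mulr1 pE_pairM ?pE1 -?mpolyC1 ?pDC// gi_inj eqxx andbT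
    mulr1.
by rewrite sumr_const card_ord mulrnAC.
Qed.

Lemma pE_wishart2 (l : 'rV[R]_d) :
  map_mx pE (wishart *m pC I (diag_mx l) *m wishart) =
  diag_mx (\row_p (n%:R * ((n%:R + 1) * l 0 p + \sum_q l 0 q))).
Proof.
apply/matrixP => a b; rewrite !mxE raddf_sum/=.
(* Here [i] and [j] index the columns summed in the two Wishart factors. Of the three Wick pairings,
   the one inside each factor is free of constraint on [i] and [j]; the two crossing pairings force
   [i = j]. *)
have termE q : pE ((wishart *m pC I (diag_mx l)) a q * wishart q b) =
    l 0 q * \sum_(i < n) \sum_(j < n)
      ((a == q)%:R * (q == b)%:R
       + (i == j)%:R * ((a == q)%:R * (q == b)%:R + (a == b)%:R)).
  rewrite mxE (bigD1 q)//= big1 => [|r rq]; last first.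
    by rewrite !mxE (negPf rq) mulr0n mpolyC0 mulr0.
  rewrite addr0 !mxE eqxx mulr1n mulrAC mulrC pECM; congr (_ * _).
  rewrite mulr_suml raddf_sum/=; apply: eq_bigr => i _.
  rewrite mulr_sumr raddf_sum/=; apply: eq_bigr => j _.
  rewrite !mxE mulrA pE_wick4 !gi_inj !eqxx !andbT.
  case: (i == j); case: (a == q); case: (q == b); case: (a == b);
    rewrite /=; ring.
under eq_bigr do rewrite termE.
have sumE q : \sum_(i < n) \sum_(j < n)
      ((a == q)%:R * (q == b)%:R
       + (i == j)%:R * ((a == q)%:R * (q == b)%:R + (a == b)%:R)) =
   n%:R * ((n%:R + 1) * ((a == q)%:R * (q == b)%:R) + (a == b)%:R) :> R.
  under eq_bigr => i _.
    rewrite big_split/= sumr_const card_ord -mulr_suml.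
    rewrite (bigD1 i)//= eqxx big1 => [|j ji]; last by rewrite eq_sym (negPf ji).
    rewrite addr0 mul1r.
    over.
  rewrite sumr_const card_ord -mulr_natl -[in X in _ * X]mulr_natl.
  by ring.
under eq_bigr do rewrite sumE.
case: (eqVneq a b) => [<-|ab]; last first.
  rewrite mulr0n big1// => q _; case: (eqVneq a q) => [<-|_].
    by rewrite (negPf ab) !(mulr0, addr0).
  by rewrite !(mul0r, mulr0, addr0).
rewrite mulr1n -[in RHS](_ : \sum_q (l 0 q * ((a == q)%:R * (q == a)%:R)) = l 0 a).
  rewrite mulr_sumr -big_split mulr_sumr/=; apply: eq_bigr => q _; ring.
rewrite (bigD1 a)//= big1 => [|q qa]; first by rewrite eqxx !mulr1 addr0.
by rewrite (negPf qa) !mulr0.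
Qed.
End Wishart.
Arguments gmx {R I d n}.
Arguments wishart {R I d n}.

(** * The in-context loss *)

Section Loss.
Variables (R : realType) (d n : nat) (U : 'M[R]_d) (lam : 'rV[R]_d).
Local Notation J := (('I_d * 'I_(n + 1) + 'I_d)%type : finType).
Local Notation P := (mpoly #|J| R).
Local Notation cst := (@pC R J _ _).

Definition sqlam : 'rV[R]_d := map_mx Num.sqrt lam.
Definition mixU : 'M[R]_d := U *m diag_mx sqlam.
Definition pw : 'cV[P]_d := gvec inr.
Definition px : 'cV[P]_d := cst mixU *m gvec (fun i => inl (i, rshift n ord0)).
Definition pXn : 'M[P]_(d, n) := cst mixU *m gmx (fun i j => inl (i, lshift 1 j)).
Definition pZ : 'M[P]_(d + 1, n) := col_mx pXn (pw^T *m pXn).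

(* [perr b A] is [[Z_1]_{d+1,n+1} + w^T x^(n+1)] as a formal polynomial. *)
Definition perr (b : 'cV[R]_(d + 1)) (A : 'M[R]_(d + 1, d)) : P :=
  (pw^T *m px + (mpolyC _ n%:R^-1)
     *: ((cst b)^T *m (pZ *m pZ^T) *m cst A *m px)) 0 0.

(** The mask removes the query column from the Gram matrix, so [Z0 M Z0^T] is [Zl Zl^T]. Since [P]
    has only its last row and the query label is 0, the predicted entry is the form in [b] and [A]
    alone. *)
Lemma floss_perr b A : floss n U lam b A = (pE (perr b A ^+ 2))%:E.
Proof.
rewrite -gauss_expect_peval /floss; congr gauss_expect; apply/funext => om.
rewrite rmorphXn/=; congr (_ ^+ 2)%:E.
set X := Xmat U lam om.
have evw : map_mx (peval om) pw = wstar om.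
  by apply/matrixP => i j; rewrite !mxE/= peval_pX.
have evXn : map_mx (peval om) pXn = lsubmx X.
  rewrite map_mxM/= peval_pC -mulmx_lsub; congr (_ *m _).
  by apply/matrixP => i j; rewrite !mxE/= peval_pX.
have evx : map_mx (peval om) px = rsubmx X.
  rewrite map_mxM/= peval_pC -mulmx_rsub; congr (_ *m _).
  by apply/matrixP => i j; rewrite !mxE/= peval_pX !ord1.
pose Zl := col_mx (lsubmx X) ((wstar om)^T *m lsubmx X).
have evZ : map_mx (peval om) pZ = Zl.
  by rewrite map_col_mx (map_mxM (peval om) pw^T)/= -matrix.map_trmx evw evXn.
have -> : peval om (perr b A) = ((wstar om)^T *m rsubmx X +
    n%:R^-1 *: (b^T *m (Zl *m Zl^T) *m A *m rsubmx X)) 0 0.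
  rewrite /perr -evZ -evx -evw -[in RHS](peval_pC om b) -[in RHS](peval_pC om A).
  rewrite -[in RHS](pevalC om n%:R^-1).
  move: pZ px pw {evZ evx evw evXn} => Z x w.
  rewrite !matrix.map_trmx -!map_mxM -map_mxZ -map_mxD [RHS]mxE.
  by [].
have ZE : Z0 U lam om = row_mx Zl (col_mx (rsubmx X) 0).
  by rewrite /Z0 -/X -block_mxEh block_mxEv hsubmxK.
have ZMZ : Z0 U lam om *m Mmask R n *m (Z0 U lam om)^T = Zl *m Zl^T.
  rewrite ZE /Mmask tr_row_mx mul_row_block !mulmx0 !addr0 mulmx1.
  by rewrite mul_row_col mul0mx addr0.
have AZ : Qmat A *m rsubmx (Z0 U lam om) = A *m rsubmx X.
  by rewrite ZE row_mxKr mul_row_col mulmx0 addr0.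
suff -> : Z1 U lam b A om (rshift d ord0) (rshift n ord0) =
    (n%:R^-1 *: (b^T *m (Zl *m Zl^T) *m A *m rsubmx X)) 0 0.
  by rewrite addrC [RHS]mxE.
(* The sought entry is the 1 x 1 lower right block, which allows block algebra from here on. *)
transitivity (drsubmx (Z1 U lam b A om) 0 0); first by rewrite !mxE.
rewrite /Z1 !mulmxA -(mulmxA (Pmat b)) -(mulmxA (Pmat b)) ZMZ.
have dr0 : drsubmx (Z0 U lam om) = 0.
  by rewrite /drsubmx ZE -{1}[Zl]vsubmxK -block_mxEh block_mxEv col_mxKd row_mxKr.
congr (fun_of_matrix _ _ _).
rewrite /drsubmx !linearD/= !linearZ/= -/(drsubmx _) dr0 add0r.
congr (_ *: _).
rewrite -!mulmxA -mul_dsub_mx col_mxKd -(mulmx_rsub b^T) -(mulmx_rsub Zl).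
by rewrite -(mulmx_rsub Zl^T) -(mulmx_rsub (Qmat A)) AZ.
Qed.

(** The error depends on [b] and [A] only through their products, so the scalars cancel. *)
Lemma perr_scale (gamma : R) (b : 'cV[R]_(d + 1)) (A : 'M[R]_(d + 1, d)) :
  gamma != 0 ->
  perr (gamma *: b) (gamma^-1 *: A) = perr b A.
Proof.
move=> g0; rewrite /perr.
move: (pw^T *m px) (pZ *m pZ^T) px => e G x.
have gg : mpolyC #|J| gamma * mpolyC #|J| gamma^-1 = 1.
  by rewrite -mpolyCM divff// mpolyC1.
suff -> : (cst (gamma *: b))^T *m G *m cst (gamma^-1 *: A) *m x =
  (cst b)^T *m G *m cst A *m x by [].
rewrite pCZ linearZ/= pCZ -!scalemxAl -scalemxAr -scalemxAl.
by rewrite scalerA gg scale1r.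
Qed.

Definition optdiag : 'rV[R]_d :=
  \row_i ((n.+1%:R / n%:R) * lam 0 i + n%:R^-1 * \sum_k lam 0 k)^-1.
Definition optS : 'M[R]_d := U *m diag_mx optdiag *m U^T.
Definition pK : 'M[P]_d := pXn *m pXn^T.
Definition pv : 'cV[P]_d :=
  px - (mpolyC _ n%:R^-1) *: (pK *m cst optS *m px).

(** The vector [bopt] selects the label row of the Gram matrix, and the zero row of [Aopt] discards
    its label column; what is left is [w^T K], so [w^T] factors out. *)
Lemma perr_opt : perr (bopt R d) (Aopt n U lam) = (pw^T *m pv) 0 0.
Proof.
rewrite /perr /pv /pK /pZ; move: pXn px pw => X x w.
have AoptE : cst (Aopt n U lam) = - col_mx (cst optS) 0.
  by rewrite /Aopt /pC map_mxN map_col_mx/= map_mx0.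
have boptE : cst (bopt R d) = col_mx 0 1%:M.
  by rewrite /bopt /pC map_col_mx/= map_mx0 map_mx1.
have -> : (cst (bopt R d))^T *m (col_mx X (w^T *m X) *m (col_mx X (w^T *m X))^T)
    *m cst (Aopt n U lam) *m x = - (w^T *m (X *m X^T *m cst optS *m x)).
  rewrite AoptE boptE; move: (cst optS) => S.
  rewrite mulmxN mulNmx !tr_col_mx trmx0 trmx1 mulmxA mul_row_col mul0mx add0r.
  rewrite mul1mx -[_ *m row_mx _ _ *m col_mx _ _]mulmxA mul_row_col.
  by rewrite mulmx0 addr0 !mulmxA.
by rewrite mulmxBr -scalemxAr scalerN.
Qed.
End Loss.

(* Isolates [g *m g^T], which has expectation the identity. *)
Lemma cross_factor (A : comNzRingType) (d : nat) (c : A) (t s W : 'M[A]_d)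
    (g : 'cV[A]_d) :
  t *m W *m t^T *m (t *m g - c *: (t *m W *m t^T *m s *m (t *m g))) *m (t *m g)^T =
  (t *m W *m (t^T *m t) -
   c *: (t *m (W *m (t^T *m t) *m W) *m (t^T *m s *m t))) *m g *m g^T *m t^T.
Proof.
rewrite trmx_mul mulmxBr !mulmxBl -!scalemxAl -scalemxAr -!scalemxAl.
by rewrite !mulmxA.
Qed.

(** * Orthogonality of the optimal error and minimality *)

Section Optimality.
Variables (R : realType) (d n : nat) (U : 'M[R]_d) (lam : 'rV[R]_d).
Hypothesis n_gt0 : (0 < n)%N.
Hypothesis U_orth : U *m U^T = 1%:M.
Hypothesis lam_ge0 : forall i, 0 <= lam 0 i.
Local Notation J := (('I_d * 'I_(n + 1) + 'I_d)%type : finType).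
Local Notation P := (mpoly #|J| R).
Local Notation cst := (@pC R J _ _).
Local Notation T := (mixU U lam).
Local Notation S := (optS n U lam).
Local Notation w := (@pw R d n).
Local Notation x := (@px R d n U lam).
Local Notation Xn := (@pXn R d n U lam).
Local Notation K := (@pK R d n U lam).
Local Notation v := (@pv R d n U lam).
Local Notation Z := (@pZ R d n U lam).

Lemma mixU_gram : T^T *m T = diag_mx lam.
Proof.
rewrite /mixU trmx_mul tr_diag_mx mulmxA -[_ *m U^T *m U]mulmxA.
rewrite (mulmx1C U_orth) mulmx1 mulmx_diag; congr diag_mx.
by apply/rowP => i; rewrite !mxE -expr2 sqr_sqrtr.
Qed.

Lemma mixU_optS : T^T *m S *m T = diag_mx (\row_i (lam 0 i * optdiag n lam 0 i)).
Proof.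
rewrite /mixU /optS trmx_mul tr_diag_mx !mulmxA.
rewrite -[_ *m U^T *m U]mulmxA (mulmx1C U_orth) mulmx1.
rewrite -[_ *m U^T *m U]mulmxA (mulmx1C U_orth) mulmx1 !mulmx_diag.
congr diag_mx; apply/rowP => i; rewrite !mxE.
by rewrite mulrAC -expr2 sqr_sqrtr.
Qed.

Lemma optdiagK i :
  ((n%:R + 1) * lam 0 i + \sum_k lam 0 k) * (lam 0 i * optdiag n lam 0 i)
  = n%:R * lam 0 i.
Proof.
have n0 : n%:R != 0 :> R by rewrite pnatr_eq0 -lt0n.
have sum_ge : lam 0 i <= \sum_k lam 0 k.
  by rewrite (bigD1 i)//= lerDl sumr_ge0.
(* For a zero eigenvalue the inverted denominator may vanish too, but both sides carry the factor
   [lam 0 i]. For a positive one the denominator is positive. *)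
have [->|lam_neq0] := eqVneq (lam 0 i) 0; first by rewrite !(mulr0, mul0r).
have lam_gt0 : 0 < lam 0 i by rewrite lt_neqAle eq_sym lam_neq0 lam_ge0.
rewrite /optdiag mxE -natr1.
set s := \sum_k lam 0 k in sum_ge *.
have den0 : (n%:R + 1) * lam 0 i + s != 0.
  by rewrite gt_eqF// ltr_wpDr ?(le_trans (lam_ge0 i))// mulr_gt0//.
by field; rewrite n0 den0.
Qed.

Lemma gfree_px : gfree inr x.
Proof.
apply: gfreeM; first exact: gfreeC.
by move=> b; apply/matrixP => i j; rewrite !mxE pD_pX.
Qed.

Lemma gfree_pXn : gfree inr Xn.
Proof.
apply: gfreeM; first exact: gfreeC.
by move=> b; apply/matrixP => i j; rewrite !mxE pD_pX.
Qed.

Lemma gfree_pK : gfree inr K.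
Proof. by apply: gfreeM; [|apply: gfree_tr]; exact: gfree_pXn. Qed.

Lemma gfree_pv : gfree inr v.
Proof.
apply: gfree_subZ; first exact: gfree_px.
apply: gfreeM; last exact: gfree_px.
by apply: gfreeM; [exact: gfree_pK|exact: gfreeC].
Qed.

Local Notation W := (wishart (fun (i : 'I_d) (j : 'I_n) => inl (i, lshift 1 j) : J)).
Local Notation g := (gvec (fun i : 'I_d => inl (i, rshift n ord0) : J) : 'cV[P]_d).

Lemma pKE : K = cst T *m W *m cst T^T.
Proof. by rewrite /pK /pXn trmx_mul pC_tr !mulmxA. Qed.

(** Context and query columns use disjoint coordinates: the formal counterpart of their
    independence. *)
Lemma gfree_wishart : gfree (fun i => inl (i, rshift n ord0)) (W : 'M[P]_d).
Proof.
have fG : gfree (fun i => inl (i, rshift n ord0))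
    (gmx (fun (i : 'I_d) (j : 'I_n) => inl (i, lshift 1 j)) : 'M[P]_(d, n)).
  move=> b; apply/matrixP => i j; rewrite !mxE pD_pX.
  rewrite (_ : _ == _ = ((b, rshift n ord0) == (i, lshift 1 j)))// xpair_eqE.
  by rewrite eq_rlshift andbF.
by apply: gfreeM => //; exact: gfree_tr.
Qed.

Lemma pE_cross : map_mx pE (K *m v *m x^T) = 0.
Proof.
(* [B] gathers all that stands left of [g g^T] in [cross_factor], with the products involving [U]
   reduced to diagonal matrices. As it is free of [g], replacing [g g^T] by the identity leaves only
   its own mean to compute. *)
pose B : 'M[P]_d := cst T *m W *m cst (diag_mx lam) - mpolyC _ n%:R^-1 *:
  (cst T *m (W *m cst (diag_mx lam) *m W) *m cst (T^T *m S *m T)).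
have -> : K *m v *m x^T = B *m g *m g^T *m cst T^T.
  have gramE : cst (diag_mx lam) = cst T^T *m cst T by rewrite -mixU_gram [LHS]pCM.
  have TSTE : cst (T^T *m S *m T) = cst T^T *m cst S *m cst T.
    by rewrite [LHS]pCM; congr (_ *m _); exact: pCM.
  by rewrite /pv pKE /B gramE TSTE (pC_tr J T); exact: cross_factor.
have fB : gfree (fun i => inl (i, rshift n ord0)) B.
  by apply: gfree_subZ;
    repeat (first [exact: gfreeC|exact: gfree_wishart|apply: gfreeM]).
rewrite pE_mulmxC pE_gvec_cov//; last by move=> i j [].
suff -> : map_mx pE B = 0 by rewrite mul0mx.
have -> : map_mx pE B = map_mx pE (cst T *m W *m cst (diag_mx lam)) -
    n%:R^-1 *: map_mx pE
      (cst T *m (W *m cst (diag_mx lam) *m W) *m cst (T^T *m S *m T)).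
  exact: pE_subZ.
have inj_gi (i : 'I_d) (j : 'I_n) i' j' :
    ((inl (i, lshift 1 j) : J) == inl (i', lshift 1 j')) = (i == i') && (j == j').
  by rewrite -[LHS]/((i, lshift 1 j) == (i', lshift 1 j')) xpair_eqE eq_lshift.
have E1 : map_mx pE (cst T *m W *m cst (diag_mx lam)) = T *m (n%:R *: diag_mx lam).
  by rewrite pE_mulmxC pE_mulCmx pE_wishart// -mulmxA mul_scalar_mx.
have E2 : map_mx pE (cst T *m (W *m cst (diag_mx lam) *m W) *m cst (T^T *m S *m T)) =
    T *m (diag_mx (\row_p (n%:R * ((n%:R + 1) * lam 0 p + \sum_q lam 0 q)))
    *m (T^T *m S *m T)).
  by rewrite pE_mulmxC pE_mulCmx pE_wishart2// [RHS]mulmxA.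
rewrite E1 E2 mixU_optS mulmx_diag scalemxAr -mulmxBr.
(* Both Wishart moments are now diagonal, and the cancellation is [optdiagK] read entry by entry. *)
suff -> : n%:R *: diag_mx lam = n%:R^-1 *: diag_mx (\row_j
    ((\row_p (n%:R * ((n%:R + 1) * lam 0 p + \sum_q lam 0 q))) 0 j *
     (\row_i (lam 0 i * optdiag n lam 0 i)) 0 j)).
  by rewrite subrr mulmx0.
rewrite -!linearZ; congr diag_mx; apply/rowP => i.
have oK := optdiagK i; move: (optdiag n lam) oK => o oK.
by rewrite !mxE -mulrA oK mulKf// pnatr_eq0 -lt0n.
Qed.

Lemma pE_orth k l a : pE ((w^T *m v) 0 0 * ((Z *m Z^T) k l * x a 0)) = 0.
Proof.
have fv := gfree_pv; have fx := gfree_px; have fK := gfree_pK.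
(* The blocks have degrees 0, 1, 1 and 2 in [w]; after multiplication by [w^T v] only the
   off-diagonal ones have even degree, and these are settled by [pE_cross]. *)
have ZE : Z *m Z^T = block_mx K (K *m w) (K *m w)^T (w^T *m K *m w).
  rewrite /pZ /pK; move: Xn w => X u.
  by rewrite tr_col_mx mul_col_row !trmx_mul !trmxK !mulmxA.
have mixed i : pE ((w^T *m v) 0 0 * ((K *m w) i 0 * x a 0)) = 0.
  rewrite pE_gvec2//; last by move=> ? ? [].
  by have /matrixP/(_ i a) := pE_cross; rewrite !mxE.
rewrite ZE; case: (split_ordP k) => i ->; case: (split_ordP l) => j ->;
  rewrite ?(ord1 i) ?(ord1 j).
- by rewrite block_mxEul pE_gvec1.
- by rewrite block_mxEur mixed.
- by rewrite block_mxEdl [_^T _ _]mxE mixed.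
- by rewrite block_mxEdr pE_gvec3.
Qed.

Lemma pE_orth_form (B : 'rV[R]_(d + 1)) (A : 'M[R]_(d + 1, d)) :
  pE ((w^T *m v) 0 0 * (cst B *m (Z *m Z^T) *m cst A *m x) 0 0) = 0.
Proof.
have orth := pE_orth; move: ((w^T *m v) 0 0) (Z *m Z^T) x orth => e G y orth.
rewrite mxE mulr_sumr raddf_sum big1//= => a _.
rewrite mxE mulr_suml mulr_sumr raddf_sum big1//= => l _.
rewrite mxE !mulr_suml mulr_sumr raddf_sum big1//= => k _.
rewrite ![cst _ _ _]mxE.
rewrite [X in pE X](_ : _ = mpolyC _ (B 0 k) * (mpolyC _ (A l a) *
  (e * (G k l * y a 0)))); last by ring.
by rewrite !pECM orth !mulr0.
Qed.

Lemma pE_perr_min b A :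
  pE (perr n U lam (bopt R d) (Aopt n U lam) ^+ 2) <= pE (perr n U lam b A ^+ 2).
Proof.
set e := perr n U lam (bopt R d) _; set D := perr n U lam b A - e.
have -> : perr n U lam b A = e + D by rewrite /D addrC subrK.
have eD : pE (e * D) = 0.
  pose form (b' : 'cV[R]_(d + 1)) (A' : 'M[R]_(d + 1, d)) :=
    (cst b'^T *m (Z *m Z^T) *m cst A' *m x) 0 0.
  (* The target term [w^T x] is common to both errors and cancels, so their difference is a
     combination of forms orthogonal to [e]. *)
  have -> : D = mpolyC _ n%:R^-1 *
      (form b A - form (bopt R d) (Aopt n U lam)).
    rewrite /D /e /perr /form !pC_tr.
    move: (_ *m x) (_ *m x) (_ *m x) => m1 m2 m3.
    by rewrite !mxE; ring.
  have formE b' A' : pE (e * form b' A') = 0.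
    by rewrite /e perr_opt; exact: pE_orth_form.
  move: (formE b A) (formE (bopt R d) (Aopt n U lam)).
  generalize e (form b A) (form (bopt R d) (Aopt n U lam)) => e' p q ep eq.
  by rewrite mulrCA pECM mulrBr raddfB/= ep eq subrr mulr0.
(* Pythagoras: the cross term vanishes, and the excess loss is the mean square of [D]. *)
rewrite sqrrD !raddfD/= eD !addr0 lerDl.
exact: pE_sqr_ge0.
Qed.
End Optimality.

Theorem theorem1 (R : realType) (d n : nat) (U : 'M[R]_d) (lam : 'rV[R]_d) :
  (0 < d)%N -> (0 < n)%N ->
  U *m U^T = 1%:M ->
  (forall i, 0 <= lam 0 i) ->
  (forall (b : 'cV[R]_(d + 1)) (A : 'M[R]_(d + 1, d)),
      (floss n U lam (bopt R d) (Aopt n U lam) <= floss n U lam b A)%E) /\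
  (forall gamma : R, gamma != 0 ->
    forall (b : 'cV[R]_(d + 1)) (A : 'M[R]_(d + 1, d)),
      (floss n U lam (gamma *: bopt R d) (gamma^-1 *: Aopt n U lam)
         <= floss n U lam b A)%E).
Proof.
move=> _ n_gt0 U_orth lam_ge0.
have opt b A : (floss n U lam (bopt R d) (Aopt n U lam) <= floss n U lam b A)%E.
  by rewrite !floss_perr lee_fin pE_perr_min.
split=> // gamma gamma0 b A.
by rewrite [leLHS]floss_perr perr_scale// -floss_perr.
Qed.
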